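(* Let $X$ be an ultrabarrelled topological sequence space (over $\mathbb{K}=\mathbb{R}$ or $\mathbb{C}$) in which $(e_n)_{n=1}^{\infty}$ forms a basis. Let $\nu=(v_n)_{n=1}^{\infty}$ be a sequence of nonzero scalars in $\mathbb{K}$. Suppose that the unilateral weighted backward shift $T_\nu$, given by $$T_\nu(u_1,u_2,u_3,\cdots)=(v_2u_2,v_3u_3,v_4u_4,\cdots),$$ is a continuous linear operator on $X$ (in particular $T_\nu$ maps $X$ into $X$). Then $T_\nu$ is mixing if and only if $\lim_{n\to\infty}\left(\prod_{i=1}^{n}v_i\right)^{-1}e_n=0$ in $X$.
   Context: $\mathbb{K}$ is $\mathbb{R}$ or $\mathbb{C}$; $\mathbb{N}^{\ast}$ is the set of positive integers; $\mathbb{K}^{\mathbb{N}^{\ast}}$ is the vector space of all scalar sequences $(u_n)_{n=1}^{\infty}$. For $n\geq 1$, $e_n$ is the sequence whose $n$-th term is $1$ and all other terms are $0$. A topological vector space is a vector space over $\mathbb{K}$ with a topology making addition and scalar multiplication continuous (such a topology is called a vector topology). A topological sequence space is a topological vector space $X$ that is a linear subspace of $\mathbb{K}^{\mathbb{N}^{\ast}}$ and in which convergence implies coordinatewise convergence (convergence of nets, i.e. each coordinate functional $(u_k)_{k}\mapsto u_n$ is continuous on $X$). Let $\mathfrak{T},\mathfrak{T}'$ be vector topologies for a vector space $X$. $\mathfrak{T}'$ is $F$ linked to $\mathfrak{T}$ if $\mathfrak{T}'$ has a local base of neighborhoods of $0$ each of which is $\mathfrak{T}$-closed. A topological vector space $(X,\mathfrak{T})$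 is ultrabarrelled if $\mathfrak{T}$ is larger than (i.e. contains) every vector topology $\mathfrak{T}'$ on $X$ which is $F$ linked to $\mathfrak{T}$. (Local convexity is not assumed.) A sequence $(\mu_n)_{n=1}^{\infty}$ in a topological vector space $X$ is a basis if every $\mu\in X$ has a unique representation $\mu=\sum_{n=1}^{\infty}\alpha_n\mu_n$ (convergence in $X$) with scalars $\alpha_n\in\mathbb{K}$. (In particular $e_n\in X$ for all $n$ when $(e_n)$ is a basis of $X$.) A continuous linear operator $S$ on a topological vector space $X$ is mixing if for any pair $U,V$ of nonempty open subsets of $X$ there is a nonnegative integer $N$ such that $S^n(U)\cap V\neq\emptyset$ for all $n\geq N$. *)

(* Defs.v *)
From HB Require Import structures.
From mathcomp Require Import all_boot all_order all_algebra.
From mathcomp Require Import complex.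
From mathcomp Require Import all_classical all_reals all_analysis.

Set Implicit Arguments.
Unset Strict Implicit.
Unset Printing Implicit Defensive.

Import GRing.Theory.

Local Open Scope classical_set_scope.
Local Open Scope ring_scope.
Local Open Scope complex_scope.

Definition real_or_complex (R : realType) (K : numFieldType) : Prop :=
  K = R :> numFieldType \/ K = R[i] :> numFieldType.

(* [Topological V] is the type of topologies on the carrier of [V]; vector
   topologies need be neither Hausdorff nor locally convex. *)
Definition vector_topology (K : numFieldType) (V : lmodType K)
    (T : Topological V) : Prop :=
  let VT := Topological.Pack T in
  continuous (fun z : VT * VT => (z.1 : V) + (z.2 : V) : VT) /\
  continuous (fun z : K^o * VT => z.1 *: (z.2 : V) : VT).

Definition F_linked (K : numFieldType) (V : lmodType K)
    (T' T : Topological V) : Prop :=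
  exists B : set_system V,
    [/\ forall W, B W -> @nbhs V (Topological.Pack T') (0 : V) W,
        forall U, @nbhs V (Topological.Pack T') (0 : V) U ->
          exists2 W, B W & W `<=` U
      & forall W, B W -> @closed (Topological.Pack T) W].

Definition ultrabarrelled (K : numFieldType) (V : topologicalLmodType K) : Prop :=
  forall T' : Topological V,
    vector_topology T' -> F_linked T' (Topological.on V) ->
    forall U : set V, @open (Topological.Pack T') U -> open U.

(* Indices are shifted: a sequence (u_n)_{n >= 1}, as well as the vectors e_n
   and the weights v_n, is a function of [k : nat] whose value at [k] is the
   term of index k + 1.  The linear subspace is carved out by [S], and [X] is
   that subspace with pointwise operations and its own topology (in general not
   the one induced by the product). *)
HB.mixin Record isTopologicalSequenceSpace (K : numFieldType)
    (S : pred (nat -> K^o)) X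
    & @GRing.SubLmodule K (nat -> K^o) S X & TopologicalLmodule K X := {
  coord_continuous : forall n, continuous (fun x : X => (val x : nat -> K^o) n)
}.

#[short(type="topologicalSequenceSpace")]
HB.structure Definition TopologicalSequenceSpace (K : numFieldType)
    (S : pred (nat -> K^o)) :=
  {X of @GRing.SubLmodule K (nat -> K^o) S X & TopologicalLmodule K X
      & @isTopologicalSequenceSpace K S X}.

Definition unit_seq (K : numFieldType) (n : nat) : nat -> K^o :=
  fun k => (k == n)%:R.

Definition schauder_basis (K : numFieldType) (X : topologicalLmodType K)
    (b : nat -> X) : Prop :=
  forall x : X, exists! a : nat -> K, [series a k *: b k]_k @ \oo --> x.

Definition backward_shift (K : numFieldType) (v : nat -> K) (u : nat -> K^o)
    : nat -> K^o :=
  fun k => v k.+1 * u k.+1.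

Definition mixing (X : topologicalType) (S : X -> X) : Prop :=
  forall U V : set X, open U -> open V -> U !=set0 -> V !=set0 ->
    exists N : nat, forall n, (N <= n)%N -> (iter n S @` U) `&` V !=set0.

(* Main.v *)
Require Import Defs.
From HB Require Import structures.
From mathcomp Require Import all_boot all_order all_algebra.
From mathcomp Require Import all_classical all_reals all_analysis.

Import Order.TTheory GRing.Theory Num.Theory.
Import numFieldNormedType.Exports.

Local Open Scope classical_set_scope.
Local Open Scope ring_scope.

(** Put w_n = (v_0 ... v_n)^-1 e_n.  The shift T sends w_(n+1) to w_n and w_0
    to 0, so (w_n) is a backward orbit of T.

    If w_n tends to 0, every finite combination y of the w_k has the preimage
    under T^n obtained by raising all indices by n, and these preimages tend to
    0, whereas T^n x vanishes for large n when x is another such combination.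
    The finite combinations are dense because (e_n) is a basis, and for dense x
    and y the vector x + r_n, with T^n r_n = y and r_n small, lies near x and is
    sent near y: this is [mixing_criterion].

    Conversely, let T be mixing.  For large n there is a small x such that T^n x
    is close to e_0 in its coordinate of index 0.  Up to the factor v_0 that
    coordinate is (v_0 ... v_n) x_n, so w_n is a scalar close to v_0^-1 times
    x_n e_n.  It remains to know that x_n e_n is small uniformly in n when x is
    small, which is where ultrabarrelledness comes in: the maps x |-> x_n e_n
    are continuous and tend to 0 pointwise, and such a sequence of linear maps
    is equicontinuous by a Banach-Steinhaus theorem,
    [ultrabarrelled_equicontinuous].  For that theorem, the sets
    {x | forall n, Q_n x in U} form a local base of a vector topology; pointwise
    convergence is what makes scalar multiplication continuous, and taking U
    closed shows that it is F linked to the original topology, hence coarser. *)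

(** * Neighbourhoods of the origin *)

Section NbhsZero.
Context {K : numFieldType} {Y : topologicalLmodType K}.
Implicit Types (U V : set Y) (x y : Y).

Lemma nbhs0_add U : nbhs 0 U ->
  exists2 V, nbhs 0 V & forall x y, V x -> V y -> U (x + y).
Proof.
move=> U0; have := @add_continuous Y (0, 0) U.
rewrite /= addr0 => /(_ U0)[[A B] /= [A0 B0] ABU].
exists (A `&` B); first exact: filterI.
by move=> x y [Ax _] [_ By]; exact: (ABU (x, y)).
Qed.

Lemma nbhs0_closed U : nbhs 0 U ->
  exists V, [/\ nbhs 0 V, closed V & V `<=` U].
Proof.
move=> U0; have := @sub_continuous Y (0, 0) U.
rewrite /= subr0 => /(_ U0)[[A B] /= [A0 B0] ABU].
exists (closure (A `&` B)); split.
- by apply: filterS (filterI A0 B0); exact: subset_closure.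
- exact: closed_closure.
(* A point of the closure is a difference of two small vectors. *)
move=> x clx; have /clx[y [[Ay By] By']] : nbhs x [set y | B (y - x)].
  apply: (@continuous_comp _ _ _ (fun y => (y, x)) (fun z : Y * Y => z.1 - z.2)).
  - by apply: cvg_pair; [exact: cvg_id | exact: cvg_cst].
  - exact: sub_continuous.
  - by rewrite /= subrr.
by have := ABU (y, y - x) (conj Ay By'); rewrite /= opprB addrC subrK.
Qed.

Lemma scale_nbhs0 (a : K) U : nbhs 0 U ->
  exists2 V, nbhs 0 V & \forall b \near (a : K^o), forall x, V x -> U (b *: x).
Proof.
move=> U0; have := @scale_continuous K Y (a, 0) U.
rewrite /= scaler0 => /(_ U0)[[A B] /= [A0 B0] ABU].
by exists B => //; apply: filterS A0 => b Ab x Bx; exact: (ABU (b, x)).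
Qed.

Lemma scale_near0 x U : nbhs 0 U -> \forall b \near (0 : K^o), U (b *: x).
Proof.
move=> U0; have := @scale_continuous K Y (0, x) U.
rewrite /= scale0r => /(_ U0)[[A B] /= [A0 B0] ABU].
by apply: filterS A0 => b Ab; apply: (ABU (b, x)); split => //=; exact: nbhs_singleton.
Qed.

End NbhsZero.

(** A null sequence is bounded: its tail is handled by joint continuity of the
    scalar multiplication at (0, 0), the finitely many remaining terms one by
    one. *)
Lemma null_seq_scale_near0 {K : numFieldType} {Y : topologicalLmodType K} (q : nat -> Y)
    (U : set Y) : q @ \oo --> (0 : Y) -> nbhs 0 U ->
  \forall b \near (0 : K^o), forall n, U (b *: q n).
Proof.
move=> q0 U0; have [V V0 VU] := scale_nbhs0 0 U U0.
have [N _ qV] := q0 V V0.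
near=> b => n; case: (ltnP n N) => [nN|Nn]; last first.
  by apply: (near VU b) => //; exact: qV.
rewrite -[n]/(nat_of_ord (Ordinal nN)); move: (Ordinal nN) => i.
move: i; near: b; apply: filter_forall => i; exact: scale_near0.
Unshelve. all: by end_near. Qed.

(** * Banach-Steinhaus in ultrabarrelled spaces *)

Section UniformPullback.
Context {K : numFieldType} {X Y : topologicalLmodType K}.
Variable Q : nat -> {linear X -> Y}.

(** A copy of [X], so that the topology in which x is small when all the [Q n x]
    are, uniformly in n, can coexist with the topology of [X]. *)
Definition uniform_pullback : Type := X.

Definition uball (U : set Y) : set X := [set x | forall n, U (Q n x)].

Definition uniform_nbhs (x : X) : set_system X :=
  [set A | exists2 U : set Y, nbhs 0 U & forall y, uball U (y - x) -> A y].

HB.instance Definition _ := Choice.on uniform_pullback.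
HB.instance Definition _ :=
  hasNbhs.Build uniform_pullback (uniform_nbhs : uniform_pullback -> _).

Lemma uniform_nbhs_filter (x : uniform_pullback) : ProperFilter (nbhs x).
Proof.
split.
  move=> [U U0] /(_ x); apply => n; rewrite subrr linear0; exact: nbhs_singleton.
split.
- by exists setT; first exact: filterT.
- move=> A B [U U0 UA] [V V0 VB]; exists (U `&` V); first exact: filterI.
  by move=> y yUV; split; [apply: UA|apply: VB] => n; case: (yUV n).
- by move=> A B AB [U U0 UA]; exists U => // y /UA /AB.
Qed.

Lemma uniform_nbhs_singleton (x : uniform_pullback) (A : set uniform_pullback) :
  nbhs x A -> A x.
Proof.
by move=> [U U0]; apply => n; rewrite subrr linear0; exact: nbhs_singleton.
Qed.

Lemma uniform_nbhs_nbhs (x : uniform_pullback) (A : set uniform_pullback) :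
  nbhs x A -> nbhs x (nbhs^~ A).
Proof.
move=> [U U0 UA]; have [V V0 VU] := nbhs0_add U U0.
exists V => // y yV; exists V => // z zV; apply: UA => n.
by rewrite -(subrK (y : X) z) -addrA linearD; exact: VU.
Qed.

HB.instance Definition _ := Nbhs_isNbhsTopological.Build uniform_pullback
  uniform_nbhs_filter uniform_nbhs_singleton uniform_nbhs_nbhs.

Definition uniform_topology : Topological X := Topological.on uniform_pullback.

Hypothesis Q0 : forall x, Q ^~ x @ \oo --> (0 : Y).

(** Addition is always continuous for this topology.  For scalars, write
    b y - a x = (b - a) x + b (y - x): the first term is uniformly small because
    the null sequence (Q_n x) is bounded. *)
Lemma uniform_vector_topology : vector_topology uniform_topology.
Proof.
split.
  move=> [x y] A; rewrite /= => -[U U0 UA].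
  have [V V0 VU] := nbhs0_add U U0.
  exists ([set a | uball V (a - x)], [set b | uball V (b - y)]).
    by split; exists V.
  move=> [a b] /= [aV bV]; apply: UA => n.
  by rewrite opprD addrACA linearD; exact: VU.
move=> [a x] A [U U0 UA]; have [V V0 VU] := nbhs0_add U U0.
have [W W0 WV] := scale_nbhs0 a V V0.
have /(null_seq_scale_near0 _ V (Q0 x)) cV := V0.
exists ([set b : K^o | (forall n, V ((b - a) *: Q n x)) /\ forall y, W y -> V (b *: y)],
        [set y | uball W (y - x)]).
  split; last by exists W.
  apply: filterI => //.
  have h : (fun b : K^o => b - a) @ (a : K^o) --> (0 : K^o).
    rewrite -(subrr (a : K^o)); apply: (@cvgB K K^o _ (nbhs (a : K^o)));
      [exact: cvg_id|exact: cvg_cst].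
  exact: (h _ cV).
move=> [b y] /= [[ba bW] yW]; apply: UA => n.
rewrite (_ : b *: y - a *: x = (b - a) *: x + b *: (y - x)).
  by rewrite linearD !linearZ_LR; apply: VU; [exact: ba|exact: bW].
by rewrite scalerBl scalerBr [RHS]addrC addrA subrK.
Qed.

Hypothesis Qc : forall n, continuous (Q n).

(** The balls of closed neighbourhoods form a local base, and each is an
    intersection of closed sets since the [Q n] are continuous. *)
Lemma uniform_F_linked : F_linked uniform_topology (Topological.on X).
Proof.
exists [set W | exists2 U : set Y, nbhs 0 U /\ closed U & W = uball U].
split.
- by move=> _ [U [U0 _] ->]; exists U => // y; rewrite subr0.
- move=> A [U U0 UA]; have [V [V0 cV VU]] := nbhs0_closed U U0.
  exists (uball V); first by exists V.
  by move=> y yV; apply: UA => n; rewrite subr0; exact: VU.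
- move=> _ [U [_ cU] ->].
  rewrite (_ : uball U = \bigcap_n (Q n @^-1` U)).
    by apply: closed_bigI => n _; apply: preimage_closed => // x; exact: Qc.
  by apply/seteqP; split=> [x Ux n _|x Ux n]; [exact: Ux|exact: (Ux n I)].
Qed.

(** Ultrabarrelledness makes the topology of uniform smallness coarser than that
    of [X], so the interior of a uniform ball in the former is a neighbourhood
    of 0 in the latter. *)
Lemma ultrabarrelled_equicontinuous (U : set Y) :
  ultrabarrelled X -> nbhs 0 U -> \forall x \near (0 : X), forall n, U (Q n x).
Proof.
move=> hX U0.
have /(_ [set x : X | uniform_nbhs x (uball U)]) :=
  hX _ uniform_vector_topology uniform_F_linked.
have oU : @open uniform_pullback
    [set x : uniform_pullback | uniform_nbhs x (uball U)].
  rewrite openE => x; exact: uniform_nbhs_nbhs.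
move=> /(_ oU) oUX.
have : nbhs (0 : X) [set x : X | uniform_nbhs x (uball U)].
  by apply: open_nbhs_nbhs; split => //; exists U => // y; rewrite subr0.
by apply: filterS => x; exact: uniform_nbhs_singleton.
Qed.

End UniformPullback.

(** * A criterion for mixing *)

Section TopologicalLmod.
Context {K : numFieldType} {X : topologicalLmodType K}.

Lemma iter_add (T : {linear X -> X}) n (x y : X) :
  iter n T (x + y) = iter n T x + iter n T y.
Proof. by elim: n => //= n ->; rewrite linearD. Qed.

Lemma iter_linear_sum (T : {linear X -> X}) n N (a : nat -> K) (f : nat -> X) :
  iter n T (\sum_(k < N) a k *: f k) = \sum_(k < N) a k *: iter n T (f k).
Proof.
by elim: n => //= n ->; rewrite linear_sum; apply: eq_bigr => k _; rewrite linearZ_LR.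
Qed.

Lemma cvg_add (u w : nat -> X) (x y : X) : u @ \oo --> x -> w @ \oo --> y ->
  (fun n => u n + w n) @ \oo --> x + y.
Proof. by move=> ux wy; exact: (cvg_comp2 ux wy (add_continuous (x, y))). Qed.

Lemma cvg_scale (a : K) (u : nat -> X) (x : X) : u @ \oo --> x ->
  (fun n => a *: u n) @ \oo --> a *: x.
Proof.
by move=> ux; exact: (cvg_comp2 (cvg_cst (a : K^o)) ux (@scale_continuous K X (a, x))).
Qed.

Lemma cvgDnull (x : X) (u : nat -> X) :
  u @ \oo --> (0 : X) -> (fun n => x + u n) @ \oo --> x.
Proof.
move=> u0; have := cvg_add (fun=> x) u x 0; rewrite addr0; apply=> //.
exact: cvg_cst.
Qed.

Lemma cvg_lincomb0 N (a : nat -> K) (u : nat -> nat -> X) :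
  (forall k, u k @ \oo --> (0 : X)) ->
  (fun n => \sum_(k < N) a k *: u k n) @ \oo --> (0 : X).
Proof.
move=> u0; elim: N => [|N IHN].
  by under eq_fun do rewrite big_ord0; exact: cvg_cst.
under eq_fun do rewrite big_ord_recr /=.
by have := cvg_add _ _ _ _ IHN (cvg_scale (a N) _ _ (u0 N)); rewrite scaler0 addr0.
Qed.

(** For x and y in [D] and r_n a small preimage of y under T^n, the vector
    x + r_n stays near x and T^n (x + r_n) = T^n x + y approaches y. *)
Lemma mixing_criterion (T : {linear X -> X}) (D : set X) :
  dense D ->
  (forall x, D x -> (fun n => iter n T x) @ \oo --> (0 : X)) ->
  (forall y, D y -> exists2 r : nat -> X,
    r @ \oo --> (0 : X) & forall n, iter n T (r n) = y) ->
  mixing T.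
Proof.
move=> dD D0 Dr U V oU oV U0 V0.
have [x [Ux Dx]] := dD _ U0 oU.
have [y [Vy Dy]] := dD _ V0 oV.
have [r r0 Tr] := Dr y Dy.
have xrU : \forall n \near \oo, U (x + r n) :=
  cvgDnull x _ r0 U (open_nbhs_nbhs (conj oU Ux)).
have yTV : \forall n \near \oo, V (y + iter n T x) :=
  cvgDnull y _ (D0 x Dx) V (open_nbhs_nbhs (conj oV Vy)).
have [N _ NUV] := filterI xrU yTV.
exists N => n /NUV [/= Ux' Vy']; exists (iter n T (x + r n)); split.
  by exists (x + r n).
by rewrite iter_add Tr addrC.
Qed.

End TopologicalLmod.

(** * Coordinates in a sequence space with basis (e_n) *)

Section SequenceSpace.
Context {K : numFieldType} {S : pred (nat -> K^o)} {X : topologicalSequenceSpace S}.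
Variables (e : nat -> X).

Definition coord (n : nat) (x : X) : K := (val x : nat -> K^o) n.

Lemma continuous_coord n : continuous (coord n : X -> K^o).
Proof. exact: (@Defs.coord_continuous K S X n). Qed.

Lemma coordD n (x y : X) : coord n (x + y) = coord n x + coord n y.
Proof. by rewrite /coord raddfD. Qed.

Lemma coordZ n (a : K) (x : X) : coord n (a *: x) = a * coord n x.
Proof. by rewrite /coord linearZ. Qed.

Definition coord_part (n : nat) (x : X) : X := coord n x *: e n.

Lemma coord_part_is_linear n : linear (coord_part n).
Proof.
by move=> a x y; rewrite /coord_part coordD coordZ scalerDl scalerA.
Qed.

HB.instance Definition _ n :=
  GRing.isLinear.Build K X X _ (coord_part n) (coord_part_is_linear n).

Lemma coord_part_continuous n : continuous (coord_part n).
Proof.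
move=> x U /(@scale_continuous K X (coord n x, e n))[[A B] /= [Ax Be] ABU].
have /= := continuous_coord n x A Ax; rewrite /nbhs /=.
by apply: filterS => y Ay; apply: (ABU (_, e n)); split => //=; exact: nbhs_singleton.
Qed.

Hypothesis he : forall n, val (e n) = unit_seq K n.

Lemma coord_unit k n : coord k (e n) = (k == n)%:R.
Proof. by rewrite /coord he. Qed.

Lemma coord_sum n N (a : nat -> K) :
  coord n (\sum_(k < N) a k *: e k) = if (n < N)%N then a n else 0.
Proof.
elim: N => [|N IHN]; first by rewrite big_ord0 /coord raddf0.
rewrite big_ord_recr /= coordD IHN coordZ coord_unit ltnS.
by case: ltngtP => [nN|nN|->]; rewrite ?mulr0 ?mulr1 ?addr0 ?add0r.
Qed.

Hypothesis hbasis : schauder_basis e.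

(** The coefficients of a convergent expansion are forced to be the coordinates,
    because the coordinates are continuous and those of index n of the partial
    sums are eventually constant. *)
Lemma basis_expansion x : (fun N => \sum_(k < N) coord k x *: e k) @ \oo --> x.
Proof.
have [a [ax _]] := hbasis x; move: ax; rewrite seriesEord => ax.
suff ax_coord n : coord n x = a n.
  by under eq_fun do under eq_bigr do rewrite ax_coord.
have h1 : (fun N => coord n (\sum_(k < N) a k *: e k) : K^o) @ \oo --> (coord n x : K^o).
  by move=> A /(continuous_coord n x) /ax.
have h2 : (fun N => coord n (\sum_(k < N) a k *: e k) : K^o) @ \oo --> (a n : K^o).
  by apply: (cvg_near_cst (a n : K^o)); exists n.+1 => // N /= nN; rewrite coord_sum nN.
exact: (cvg_unique (@norm_hausdorff K K^o) h1 h2).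
Qed.

(** The terms of a convergent series are differences of consecutive partial
    sums. *)
Lemma coord_part_cvg0 x : (fun n => coord_part n x) @ \oo --> (0 : X).
Proof.
have sx := basis_expansion x.
have sx1 : (fun N => \sum_(k < N.+1) coord k x *: e k) @ \oo --> x.
  by apply: cvg_comp sx => A [N _ NA]; exists N => // n /= Nn; apply: NA; exact: leqW.
have := cvg_add _ _ _ _ sx1 (cvg_scale (-1) _ _ sx).
rewrite scaleN1r subrr.
rewrite (_ : (fun n => _) = (fun n => coord_part n x)) //.
by apply/funext => n; rewrite big_ord_recr /= scaleN1r addrAC subrr add0r.
Qed.

(** * The weighted backward shift *)

Variables (v : nat -> K) (T : {linear X -> X}).
Hypothesis hv : forall n, v n != 0.
Hypothesis hT : forall x, val (T x) = backward_shift v (val x).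

(** The scaling that makes the weights disappear: on these vectors the weighted
    shift acts as the plain backward shift. *)
Definition normalized_unit (n : nat) : X := (\prod_(i < n.+1) v i)^-1 *: e n.

Lemma coord_shift k x : coord k (T x) = v k.+1 * coord k.+1 x.
Proof. by rewrite /coord hT. Qed.

Lemma coord_iter_shift k n x :
  coord k (iter n T x) = (\prod_(i < n) v (k + i).+1) * coord (k + n) x.
Proof.
elim: n k => [|n IHn] k; first by rewrite big_ord0 mul1r addn0.
rewrite /= coord_shift IHn mulrA addSnnS big_ord_recl addn0.
by congr (_ * _ * _); apply: eq_bigr => i _; rewrite /= /bump addSnnS.
Qed.

Lemma prod_weights_neq0 n : \prod_(i < n) v i != 0.
Proof. by apply/prodf_neq0 => i _. Qed.

Lemma coord_inj (x y : X) : (forall k, coord k x = coord k y) -> x = y.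
Proof. by move=> xy; apply/val_inj/funext. Qed.

Lemma shift_normalized_unitS n : T (normalized_unit n.+1) = normalized_unit n.
Proof.
apply: coord_inj => k; rewrite coord_shift !coordZ !coord_unit eqSS.
case: eqVneq => [->|_]; last by rewrite !mulr0.
by rewrite big_ord_recr /= !mulr1 invfM mulrCA mulfV ?mulr1.
Qed.

Lemma shift_normalized_unit0 : T (normalized_unit 0) = 0.
Proof.
apply: coord_inj => k; rewrite coord_shift !coordZ !coord_unit !mulr0.
by rewrite /coord raddf0.
Qed.

Lemma iter_shift_normalized_unit n k :
  iter n T (normalized_unit (k + n)) = normalized_unit k.
Proof.
elim: n k => [|n IHn] k; first by rewrite addn0.
by rewrite iterSr addnS shift_normalized_unitS IHn.
Qed.

Lemma iter_shift_normalized_unit_eq0 n k :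
  (k < n)%N -> iter n T (normalized_unit k) = 0.
Proof.
move=> kn; rewrite -(subnK kn) iterD iterS.
have := iter_shift_normalized_unit k 0; rewrite add0n => ->.
rewrite shift_normalized_unit0; elim: (_ - _)%N => //= m ->; exact: linear0.
Qed.

Lemma lincomb_normalized_unit_dense :
  dense [set x | exists N (a : nat -> K), x = \sum_(k < N) a k *: normalized_unit k].
Proof.
move=> O [x Ox] oO.
have [N _ /(_ N (leqnn N)) /= NO] := basis_expansion x O (open_nbhs_nbhs (conj oO Ox)).
exists (\sum_(k < N) coord k x *: e k); split => //.
(* The factor undoes the normalization of e_k. *)
exists N, (fun k => coord k x * \prod_(i < k.+1) v i).
apply: eq_bigr => k _; rewrite scalerA mulfK //; exact: prod_weights_neq0.
Qed.

(** Raising all indices by n turns a finite combination of normalized vectors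
    into a preimage under T^n, which is small when the normalized vectors tend
    to 0. *)
Lemma normalized_unit_cvg0_mixing : normalized_unit @ \oo --> (0 : X) -> mixing T.
Proof.
move=> w0; apply: (mixing_criterion _ _ lincomb_normalized_unit_dense).
  move=> _ [N [a ->]]; under eq_fun do rewrite iter_linear_sum.
  apply: (cvg_lincomb0 N a (fun k n => iter n T (normalized_unit k))) => k.
  apply: (cvg_near_cst (0 : X)).
  by exists k.+1 => // n /= kn; exact: iter_shift_normalized_unit_eq0.
move=> _ [N [a ->]].
exists (fun n => \sum_(k < N) a k *: normalized_unit (k + n)).
  apply: (cvg_lincomb0 N a (fun k n => normalized_unit (k + n))) => k.
  by move=> A /w0; exact: cvg_addnl.
move=> n; rewrite (iter_linear_sum _ _ _ _ (fun k => normalized_unit (k + n))).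
by apply: eq_bigr => k _; rewrite iter_shift_normalized_unit.
Qed.

(** Mixing provides a small x with v_0 (T^n x)_0 = (v_0 ... v_n) x_n =: c near
    v_0; then c^-1 (x_n e_n) is the n-th normalized vector, and it is small
    because x_n e_n is, uniformly in n, while c^-1 is near v_0^-1. *)
Lemma mixing_normalized_unit_cvg0 :
  ultrabarrelled X -> mixing T -> normalized_unit @ \oo --> (0 : X).
Proof.
move=> hX mT U U0.
have [W W0 WU] := scale_nbhs0 (v 0)^-1 U U0.
have G0 := ultrabarrelled_equicontinuous coord_part coord_part_cvg0
  coord_part_continuous W hX W0.
have ve : (fun x => v 0 * coord 0 x : K^o) @ e 0 --> (v 0 : K^o).
  have v0e : v 0 * coord 0 (e 0) = v 0 by rewrite coord_unit mulr1.
  rewrite -[in nbhs (v 0)]v0e.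
  by apply: cvgM; [exact: cvg_cst|exact: continuous_coord].
have Ve : \forall y \near e 0,
    v 0 * coord 0 y != 0 /\ forall x, W x -> U ((v 0 * coord 0 y)^-1 *: x).
  apply: filterI; last exact: (cvgV (hv 0) ve WU).
  have /cvgrPdist_lt /(_ `|v 0|) := ve; rewrite normr_gt0 => /(_ (hv 0)).
  by apply: filterS => y; apply: contraTneq => ->; rewrite subr0 ltxx.
have [N NGV] := mT _ _ (open_interior [set x | forall n, W (coord_part n x)])
  (open_interior [set y | v 0 * coord 0 y != 0 /\
                          forall x, W x -> U ((v 0 * coord 0 y)^-1 *: x)])
  (ex_intro _ 0 G0) (ex_intro _ (e 0) Ve).
exists N => // n /NGV [_ [[x /interior_subset xG <-]]].
move=> /interior_subset [] /=; rewrite coord_iter_shift mulrA add0n.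
rewrite (_ : v 0 * _ = \prod_(i < n.+1) v i); last by rewrite big_ord_recl.
move=> Px0 /(_ _ (xG n)).
rewrite /= /coord_part scalerA invfM -mulrA mulVf ?mulr1 //.
by move: Px0; rewrite mulf_eq0 negb_or => /andP[].
Qed.

End SequenceSpace.

Theorem theorem1p6 (R : realType) (K : numFieldType)
    (hK : real_or_complex R K)
    (S : pred (nat -> K^o)) (X : topologicalSequenceSpace S)
    (hX : ultrabarrelled X)
    (e : nat -> X) (he : forall n, val (e n) = unit_seq K n)
    (hbasis : schauder_basis e)
    (v : nat -> K) (hv : forall n, v n != 0)
    (T : {linear X -> X}) (hT : forall x, val (T x) = backward_shift v (val x))
    (hTc : continuous T) :
  mixing T <->
  (fun n => (\prod_(i < n.+1) v i)^-1 *: e n) @ \oo --> (0 : X).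
Proof.
split; first exact: mixing_normalized_unit_cvg0.
exact: normalized_unit_cvg0_mixing.
Qed.
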